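(* Let $k\in\mathbb N$, and suppose $G$ and $H$ are two comain graphs with the same principal main eigenvectors. Then $\mathbf W_G(k)=\mathbf W_H(k)$.
   Context: All graphs are simple (undirected, without loops or multiple edges). A graph of order $n$ has vertex set $\{1,\dots,n\}$, and its adjacency matrix $\mathbf A=\mathbf A(G)$ is the symmetric $n\times n$ matrix whose $(i,j)$ entry is $1$ if $\{i,j\}$ is an edge and $0$ otherwise. The eigenvalues and eigenvectors of $G$ are those of $\mathbf A$. Let $\mathbf j=(1,\dots,1)$ be the all-ones $n\times 1$ column. An eigenvalue of $G$ is main if it has an associated eigenvector not orthogonal to $\mathbf j$. Two graphs are comain if they have the same set of main eigenvalues (ignoring multiplicity). Let $\mu_1,\dots,\mu_p$ be the distinct main eigenvalues of $G$, and let $\mathbf P_i$ be the orthogonal projection of $\mathbb R^n$ onto the eigenspace $\{\mathbf x\in\mathbb R^n:\mathbf A\mathbf x=\mu_i\mathbf x\}$. The eigenvector $\mathbf P_i\,\mathbf j$ is called the principal main eigenvector corresponding to $\mu_i$, and the principal main eigenvectors of $G$ are $\mathbf P_1\mathbf j,\dots,\mathbf P_p\mathbf j$. The $k$-walk matrix $\mathbf W_G(k)$ is the $n\times k$ matrix whose columns are $\mathbf j,\mathbf A\mathbf j,\mathbf A^2\mathbf j,\dots,\mathbf A^{k-1}\mathbf j$. *)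

(* Defs.v *)
From HB Require Import structures.
From mathcomp Require Import all_boot all_order all_algebra.
From mathcomp Require Import reals.
Set Implicit Arguments.
Unset Strict Implicit.
Unset Printing Implicit Defensive.
Import Order.TTheory GRing.Theory Num.Theory.
Local Open Scope ring_scope.

Record graph (n : nat) := Graph {
  edge :> rel 'I_n;
  edge_sym : symmetric edge;
  edge_irr : irreflexive edge
}.

Definition ones (R : realType) (n : nat) : 'cV[R]_n := const_mx 1.

Definition adj (R : realType) (n : nat) (G : graph n) : 'M[R]_n :=
  \matrix_(i, j) (edge G i j)%:R.

Definition orthogonal (R : realType) (n : nat) (x y : 'cV[R]_n) : Prop :=
  x^T *m y = 0.

Definition main_eigenvalue (R : realType) (n : nat) (G : graph n) (mu : R) : Prop :=
  exists x : 'cV[R]_n,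
    [/\ x != 0, adj R G *m x = mu *: x & ~ orthogonal x (ones R n)].

Definition comain (R : realType) (n m : nat) (G : graph n) (H : graph m) : Prop :=
  forall mu : R, main_eigenvalue G mu <-> main_eigenvalue H mu.

(* Matrix, acting on columns, of the orthogonal projection onto the subspace
   of the columns x such that x^T belongs to the row space of U.  The row
   space of kermx U^T is the orthogonal complement of that of U. *)
Definition orthoproj (R : realType) (n : nat) (U : 'M[R]_n) : 'M[R]_n :=
  (proj_mx U (kermx U^T))^T.

(* The library's eigenspaces consist of row vectors (v *m A = mu *: v), so the
   columns x with A *m x = mu *: x are the transposes of the elements of
   eigenspace A^T mu. *)
Definition eigenproj (R : realType) (n : nat) (A : 'M[R]_n) (mu : R) : 'M[R]_n :=
  orthoproj (eigenspace A^T mu).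

(* proj_mx U V is a projection only when U and V are in direct sum, which
   holds here since the standard inner product is positive definite. *)
Lemma eigenproj_spec (R : realType) (n : nat) (A : 'M[R]_n) (mu : R)
    (x : 'cV[R]_n) :
  A *m (eigenproj A mu *m x) = mu *: (eigenproj A mu *m x) /\
  forall y : 'cV[R]_n, A *m y = mu *: y ->
    orthogonal (x - eigenproj A mu *m x) y.
Proof.
rewrite /orthogonal /eigenproj /orthoproj; set U := eigenspace _ _.
have eigP (y : 'cV[R]_n) : (y^T <= U)%MS <-> A *m y = mu *: y.
  split=> [/eigenspaceP|e]; last by apply/eigenspaceP; rewrite -trmx_mul e linearZ.
  by rewrite -trmx_mul -linearZ /= => /trmx_inj.
have cap0 : (U :&: kermx U^T = 0)%MS.
  apply/eqP/rowV0P=> v; rewrite sub_capmx => /andP[/submxP[w ->] /sub_kermxP e].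
  have {}e : (w *m U) *m (w *m U)^T = 0 by rewrite trmx_mul mulmxA e mul0mx.
  apply/rowP=> i; rewrite [RHS]mxE; apply/eqP; rewrite -sqrf_eq0.
  move/matrixP/(_ 0 0): e; rewrite [LHS]mxE [RHS]mxE => /eqP.
  rewrite psumr_eq0 => [|j _]; last by rewrite [_^T _ _]mxE -expr2 sqr_ge0.
  by move/allP/(_ i); rewrite mem_index_enum [_^T _ _]mxE -expr2 => /(_ isT).
have sum1 : (x^T <= U + kermx U^T)%MS.
  apply: submx_full; rewrite /row_full; apply/eqP.
  have := mxrank_sum_cap U (kermx U^T); rewrite cap0 mxrank0 addn0 => ->.
  by rewrite mxrank_ker mxrank_tr subnKC ?rank_leq_row.
have eP : (proj_mx U (kermx U^T))^T *m x = (x^T *m proj_mx U (kermx U^T))^T.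
  by rewrite [RHS]trmx_mul [in RHS]trmxK.
split; first by apply/eigP; rewrite eP trmxK proj_mx_sub.
move=> y /eigP /submxP[w wE].
have {wE} -> : y = U^T *m w^T by rewrite -trmx_mul -wE [in RHS]trmxK.
rewrite mulmxA eP linearB /= trmxK.
by have /sub_kermxP -> := proj_mx_compl_sub sum1; rewrite mul0mx.
Qed.

Definition principal_main_eigenvector (R : realType) (n : nat) (G : graph n)
    (mu : R) : 'cV[R]_n :=
  eigenproj (adj R G) mu *m ones R n.

(* The principal main eigenvectors are indexed by the main eigenvalues: those
   corresponding to the same eigenvalue are compared.  Equality of the unindexed
   sets of vectors would not do: for 2 K_2 + C_4, exchanging the degrees of the
   two halves of the vertex set preserves the main eigenvalues 1, 2 and the set
   of principal main eigenvectors, but changes the degrees. *)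
Definition same_principal_main_eigenvectors (R : realType) (n : nat)
    (G H : graph n) : Prop :=
  forall mu : R, main_eigenvalue G mu -> main_eigenvalue H mu ->
    principal_main_eigenvector G mu = principal_main_eigenvector H mu.

Definition walk_matrix (R : realType) (n : nat) (G : graph n) (k : nat) :
    'M[R]_(n, k) :=
  \matrix_(i < n, l < k) (adj R G ^+ l *m ones R n) i 0.

(* Main.v *)
Require Import Defs.
From HB Require Import structures.
From mathcomp Require Import all_boot all_order all_algebra.
From mathcomp Require Import reals.
From mathcomp Require Import spectral complex.
Set Implicit Arguments.
Unset Strict Implicit.
Unset Printing Implicit Defensive.
Import Order.TTheory GRing.Theory Num.Theory.
Local Open Scope ring_scope.

(* By the spectral theorem [j] is the sum of its projections [P_mu j] onto the
   eigenspaces, so that [A^l j] is the sum of the [mu^l P_mu j].  Since [P_mu j]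
   is orthogonal to [j - P_mu j], it vanishes unless [mu] is a main eigenvalue;
   hence the main eigenvalues and the principal main eigenvectors determine
   every [A^l j]. *)

(* The minimal polynomial is insensitive to the extension of scalars to [R[i]],
   where the spectral theorem makes it a product of distinct linear factors with
   real roots. *)
Lemma symmetric_diagonalizable (R : rcfType) (n : nat) (A : 'M[R]_n) :
  A^T = A -> diagonalizable A.
Proof.
case: n A => [|n] A symA; first by rewrite [A]flatmx0; apply: diagonalizable0.
pose toC : {rmorphism R -> R[i]%C} := real_complex R.
have real_toC x : toC x \is Num.real by rewrite complex_real.
pose B := map_mx toC A.
have hermB : B \is hermsymmx.
  apply: realsym_hermsym.
    by apply/is_hermitianmxP; rewrite expr0 scale1r map_mx_id // map_trmx symA.
  by apply/mxOverP=> i j; rewrite mxE.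
have /orthomx_spectralP defB := hermitian_normalmx hermB.
have /mxOverP realD := hermitian_spectral_diag_real hermB.
(* [B] is hermitian, so these entries are already real and taking real parts loses nothing. *)
pose d := [seq complex.Re (spectral_diag B 0 i) | i <- enum 'I_n.+1].
apply/diagonalizableP; exists (undup d); first exact: undup_uniq.
rewrite -(dvdp_map toC) -mxminpoly_map -/B {}defB.
rewrite -conjVmx ?spectral_unit //.
rewrite mxminpoly_uconj ?unitmx_inv ?spectral_unit // mxminpoly_diag.
rewrite rmorph_prod; under [X in _ %| X]eq_bigr do rewrite /= map_polyXsubC.
rewrite -(big_map toC xpredT (fun z => 'X - z%:P)).
(* Injectivity of [toC] ensures that discarding repeated roots over [R] and over [R[i]] gives the
   same factors. *)
rewrite -undup_map_inj; last exact: complexI.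
suff -> : map toC d = [seq spectral_diag B 0 i | i <- enum 'I_n.+1] by [].
by rewrite -map_comp; apply: eq_map => i; apply: RRe_real.
Qed.

Section Eigenprojections.

Variables (R : realType) (n : nat).
Implicit Types (A : 'M[R]_n) (x y u : 'cV[R]_n) (mu : R) (s : seq R).

Lemma orthogonal_self x : Defs.orthogonal x x -> x = 0.
Proof.
move=> /matrixP/(_ 0 0); rewrite [LHS]mxE [RHS]mxE => /eqP.
rewrite psumr_eq0 => [/allP x0|i _]; last by rewrite [_^T _ _]mxE -expr2 sqr_ge0.
apply/matrixP=> i j; rewrite ord1 [RHS]mxE; apply/eqP.
by have := x0 i (mem_index_enum _); rewrite [_^T _ _]mxE -expr2 sqrf_eq0.
Qed.

(** With [p] the projection, [p - u] lies in the eigenspace, and as [(x - u) - (x - p)] it is also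
    orthogonal to the eigenspace, hence to itself. *)
Lemma eigenproj_eq A mu x u :
    A *m u = mu *: u ->
    (forall y, A *m y = mu *: y -> Defs.orthogonal (x - u) y) ->
  eigenproj A mu *m x = u.
Proof.
move=> eigu orthu; have [eigp orthp] := eigenproj_spec A mu x.
set p := eigenproj A mu *m x in eigp orthp *.
have eigD : A *m (p - u) = mu *: (p - u) by rewrite mulmxBr eigp eigu scalerBr.
apply/eqP; rewrite -subr_eq0; apply/eqP/orthogonal_self.
rewrite /Defs.orthogonal.
have {1}-> : p - u = (x - u) - (x - p) by rewrite opprB [RHS]addrC addrA subrK.
by rewrite [trmx (_ - _)]linearB /= mulmxBl (orthu _ eigD) (orthp _ eigD) subrr.
Qed.

(** Symmetry lets [x^T *m A *m y] be evaluated from either side, as [a] or as [b] times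
    [x^T *m y]. *)
Lemma eigenvectors_orthogonal A a b x y :
    A^T = A -> a != b -> A *m x = a *: x -> A *m y = b *: y ->
  Defs.orthogonal x y.
Proof.
move=> symA neq_ab eigx eigy; apply/eqP.
have eigxT : x^T *m A = a *: x^T by rewrite -{1}symA -trmx_mul eigx linearZ.
have: (a - b) *: (x^T *m y) == 0.
  by rewrite scalerBl scalemxAl scalemxAr -eigy -eigxT mulmxA subrr.
by rewrite scaler_eq0 subr_eq0 (negPf neq_ab).
Qed.

(** Diagonalizability splits [x] into eigenvectors, which are pairwise orthogonal and therefore are
    its projections. Allowing any larger list [s] makes it possible to expand over one list common
    to two matrices. *)
Lemma eigenproj_sum A : A^T = A ->
  exists rs : seq R, forall s x, uniq s -> {subset rs <= s} ->
    x = \sum_(mu <- s) eigenproj A mu *m x.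
Proof.
move=> symA.
have /diagonalizablePeigen[rs uniq_rs full] := symmetric_diagonalizable symA.
exists rs => s x uniq_s sub.
have: (x^T <= \sum_(mu <- s) eigenspace A mu)%MS.
  apply: submx_trans (submx1 _) _; rewrite -full big_seq.
  elim/big_ind: _ => [|U V leU leV|mu mu_rs]; first exact: sub0mx.
    by rewrite addsmx_sub leU.
  by rewrite (big_rem mu) ?sub ?addsmxSl.
rewrite !(big_nth (0 : R)) !big_mkord => /sub_sumsmxP[v defx].
pose u i : 'cV_n := (v i *m eigenspace A s`_i)^T.
have eigu i : A *m u i = s`_i *: u i.
  apply: trmx_inj; rewrite trmx_mul symA linearZ /= trmxK.
  by apply/eigenspaceP/submxMl.
have xE : x = \sum_(i < size s) u i.
  apply: trmx_inj; rewrite defx linear_sum.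
  by apply: eq_bigr => i _; rewrite [RHS]trmxK.
rewrite {1}xE; apply: eq_bigr => i _; apply/esym/eigenproj_eq => // y eigy.
(* What remains of [x - u i] is the sum of the components for the other eigenvalues. *)
rewrite xE (bigD1 i) //= addrAC subrr add0r.
rewrite /Defs.orthogonal [trmx _]linear_sum /= mulmx_suml.
apply: big1 => j neq_ji; apply: eigenvectors_orthogonal (eigu j) eigy => //.
by rewrite nth_uniq.
Qed.

Lemma exp_mul_eigenvector A mu x (l : nat) :
  A *m x = mu *: x -> A ^+ l *m x = mu ^+ l *: x.
Proof.
move=> eigx; elim: l => [|l IHl]; first by rewrite !expr0 mul1mx scale1r.
by rewrite exprSr -mulmxA eigx -scalemxAr IHl scalerA -exprS.
Qed.

End Eigenprojections.

Lemma adj_sym (R : realType) (n : nat) (G : graph n) : (adj R G)^T = adj R G.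
Proof. by apply/matrixP=> i j; rewrite !mxE edge_sym. Qed.

Lemma principal_main_eigenvector_neq0 (R : realType) (n : nat) (G : graph n)
    (mu : R) :
  principal_main_eigenvector G mu != 0 -> main_eigenvalue G mu.
Proof.
have [eigp orthp] := eigenproj_spec (adj R G) mu (ones R n).
rewrite /principal_main_eigenvector in eigp orthp *.
move: (eigenproj _ _ *m _) => p in eigp orthp *.
(* The projection [p] is itself the witness: [j - p] is orthogonal to [p], so the inner product of
   [p] with [j] is that of [p] with itself. *)
move=> p0; exists p; split=> // orth1; case/eqP: p0; apply: orthogonal_self.
have := orthp p eigp; rewrite /Defs.orthogonal [trmx (_ - _)]linearB /= mulmxBl => /eqP.
rewrite subr_eq0 => /eqP <-; rewrite -[_^T *m p]trmxK trmx_mul trmxK.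
by rewrite orth1 trmx0.
Qed.

Theorem theorem5p5 (R : realType) (n k : nat) (G H : graph n)
    (hcomain : comain R G H)
    (hsame : same_principal_main_eigenvectors R G H) :
  walk_matrix R G k = walk_matrix R H k.
Proof.
(* For arbitrary [mu], either both vectors vanish, or one is nonzero; then [mu] is main for that
   graph, by [hcomain] for both, and [hsame] applies. *)
have eq_pme (mu : R) :
    principal_main_eigenvector G mu = principal_main_eigenvector H mu.
  have [G0|] := eqVneq (principal_main_eigenvector G mu) 0; last first.
    by move=> /principal_main_eigenvector_neq0 mG; apply: hsame; last apply/hcomain.
  have [H0|] := eqVneq (principal_main_eigenvector H mu) 0; first by rewrite G0.
  by move=> /principal_main_eigenvector_neq0 mH; apply: hsame; first apply/hcomain.
have [rG sumG] := eigenproj_sum (adj_sym R G).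
have [rH sumH] := eigenproj_sum (adj_sym R H).
(* Expanding the all-ones vector over the same list for both graphs lets the two sums be compared
   term by term. *)
pose s := undup (rG ++ rH).
have eqW l : adj R G ^+ l *m ones R n = adj R H ^+ l *m ones R n.
  rewrite {1}(sumG s (ones R n)) ?undup_uniq => [|//|mu]; last first.
    by rewrite mem_undup mem_cat => ->.
  rewrite [in RHS](sumH s (ones R n)) ?undup_uniq => [|//|mu]; last first.
    by rewrite mem_undup mem_cat orbC => ->.
  rewrite !mulmx_sumr; apply: eq_bigr => mu _.
  rewrite !(exp_mul_eigenvector _ (eigenproj_spec _ _ _).1).
  by congr (_ *: _); apply: eq_pme.
by apply/matrixP=> i l; rewrite [LHS]mxE [RHS]mxE eqW.
Qed.
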